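(* Let $q$ be a prime power. If $\mathcal{F} \subset \mathrm{GL}_2(\mathbb{F}_q)$ is a maximal intersecting set, then $\mathcal{F}$ is a maximum intersecting set.
   Context: $\mathrm{GL}_2(\mathbb{F}_q)$ acts by left multiplication on $\Omega_q := \mathbb{F}_q^2\setminus\{0\}$. A subset $\mathcal{F}\subset \mathrm{GL}_2(\mathbb{F}_q)$ is intersecting if for all $A,B\in\mathcal{F}$ there exists $u\in\Omega_q$ with $Au=Bu$. An intersecting set is maximal if it is not properly contained in another intersecting set of $\mathrm{GL}_2(\mathbb{F}_q)$; it is maximum if it has the largest cardinality among all intersecting sets of $\mathrm{GL}_2(\mathbb{F}_q)$. *)

(* Defs.v *)
From HB Require Import structures.
From mathcomp Require Import all_boot all_order all_algebra all_fingroup.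

Set Implicit Arguments.
Unset Strict Implicit.
Unset Printing Implicit Defensive.

Import GRing.Theory.
Local Open Scope ring_scope.

Definition Omega (F : finFieldType) : {set 'cV[F]_2} := [set: 'cV[F]_2] :\ 0.

Definition intersecting (F : finFieldType) (S : {set {'GL_2[F]}}) : bool :=
  [forall A in S, forall B in S,
    exists u in Omega F, GLval A *m u == GLval B *m u].

Definition maximal_intersecting (F : finFieldType) (S : {set {'GL_2[F]}}) : bool :=
  maxset (@intersecting F) S.

Definition maximum_intersecting (F : finFieldType) (S : {set {'GL_2[F]}}) : Prop :=
  intersecting S /\
  (forall S' : {set {'GL_2[F]}}, intersecting S' -> (#|S'| <= #|S|)%N).

(* Main.v *)
(** Two matrices agree on a nonzero vector iff their difference is singular, that
    is, of the form [x *m y].  Since [x *m y - x' *m y'] has determinant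
    [- (x /\ x') * (y /\ y')], the Plücker relation shows that the differences
    [B - A], for [B] in an intersecting set and [A] a fixed element of it, have a
    common nonzero right or left kernel vector.  So every intersecting set lies in
    some [{B | B u = A u}] or [{B | v B = v A}].  These sets are intersecting, and
    translation, conjugation and transposition put them all in bijection with the
    stabiliser of one nonzero vector, so they have the same cardinality. *)

Require Import Defs.
From HB Require Import structures.
From mathcomp Require Import all_boot all_order all_algebra all_fingroup.
From mathcomp Require Import ring.

Set Implicit Arguments.
Unset Strict Implicit.
Unset Printing Implicit Defensive.

Import GRing.Theory.
Local Open Scope ring_scope.

Section Rank1.

Variable F : fieldType.

Lemma ord2P (i : 'I_2) : {i = 0} + {i = 1}.
Proof. by case: i => [[|[|//]] lti]; [left | right]; apply: val_inj. Qed.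

Lemma sum_ord2 (f : 'I_2 -> F) : \sum_i f i = f 0 + f 1.
Proof. by rewrite big_ord_recl big_ord1; congr (_ + f _); apply: val_inj. Qed.

Lemma det0_cVP n (A : 'M[F]_n) :
  reflect (exists2 u : 'cV_n, u != 0 & A *m u = 0) (\det A == 0).
Proof.
rewrite -det_tr; apply: (iffP det0P) => [[v v0 vA]|[u u0 Au]].
  exists v^T; first by rewrite trmx_eq0.
  by rewrite -[A]trmxK -trmx_mul vA trmx0.
exists u^T; first by rewrite trmx_eq0.
by rewrite -trmx_mul Au trmx0.
Qed.

Lemma det_mx2 (A : 'M[F]_2) : \det A = A 0 0 * A 1 1 - A 0 1 * A 1 0.
Proof.
have lift01 : lift (0 : 'I_2) 0 = 1 by exact: val_inj.
have lift10 : lift (1 : 'I_2) 0 = 0 by exact: val_inj.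
rewrite (expand_det_row _ 0) sum_ord2 /cofactor !det_mx11 !mxE /=.
by rewrite ?lift01 ?lift10 /= expr0 expr1 mul1r mulN1r mulrN.
Qed.

(** A nonzero kernel vector [u] is a linear relation between the two columns of [D]. One column is
    then a multiple of the other, so [x] is that other column and [y] lists the coefficients. *)
Lemma singular22_factor (D : 'M[F]_2) :
  \det D = 0 -> exists x y : 'I_2 -> F, forall i j, D i j = x i * y j.
Proof.
move/eqP/det0_cVP=> [u u0 Du].
have DE i : D i 0 * u 0 0 + D i 1 * u 1 0 = 0.
  by move/matrixP: Du => /(_ i 0); rewrite !mxE sum_ord2.
have [u00|u00] := eqVneq (u 0 0) 0; last first.
  exists (D^~ 1), (fun j => if j == 0 then - u 1 0 / u 0 0 else 1) => i j.
  case: (ord2P j) => -> /=; last by rewrite mulr1.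
  by apply: (mulIf u00); rewrite mulrA divfK // mulrN; apply/eqP; rewrite -addr_eq0 DE.
have u10 : u 1 0 != 0.
  apply: contra_neq u0 => u10; apply/matrixP=> i k; rewrite (ord1 k) mxE.
  by case: (ord2P i) => ->.
exists (D^~ 0), (fun j => if j == 0 then 1 else 0) => i j.
case: (ord2P j) => -> /=; first by rewrite mulr1.
by apply: (mulIf u10); rewrite mulr0 mul0r -(DE i) u00 mulr0 add0r.
Qed.

Definition wedge (x y : 'I_2 -> F) := x 0 * y 1 - x 1 * y 0.

Lemma det_rank1_sub (D D' : 'M[F]_2) x y x' y' :
    (forall i j, D i j = x i * y j) -> (forall i j, D' i j = x' i * y' j) ->
  \det (D - D') = - (wedge x x' * wedge y y').
Proof. by move=> DE D'E; rewrite det_mx2 !mxE !DE !D'E /wedge; ring. Qed.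

Lemma wedgeC x y : wedge x y = - wedge y x.
Proof. by rewrite /wedge; ring. Qed.

Lemma plucker x1 x2 x3 (i : 'I_2) :
  x1 i * wedge x2 x3 = x2 i * wedge x1 x3 - x3 i * wedge x1 x2.
Proof. by case: (ord2P i) => ->; rewrite /wedge; ring. Qed.

(** Parallelism passes through the nonzero vector [x2]: by [plucker], [x2 i * wedge x1 x3] would
    vanish if [x2] were parallel to both [x1] and [x3]. *)
Lemma wedge_neq0 (x1 x2 x3 : 'I_2 -> F) i :
  x2 i != 0 -> wedge x1 x2 = 0 -> wedge x1 x3 != 0 -> wedge x2 x3 != 0.
Proof.
move=> x2i w12 w13; apply: contraNneq (mulf_neq0 x2i w13) => w23.
by rewrite plucker w23 [wedge x2 x1]wedgeC w12 oppr0 !mulr0 subr0.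
Qed.

End Rank1.

Section IntersectingGL2.

Variable F : finFieldType.
Implicit Types (A B C g : {'GL_2[F]}) (S : {set {'GL_2[F]}}).

Lemma singular_family_kernel (P : {set 'M[F]_2}) :
    0 \in P -> {in P &, forall D E, \det (D - E) = 0} ->
  (exists2 u : 'cV_2, u != 0 & {in P, forall D, D *m u = 0}) \/
  (exists2 v : 'rV_2, v != 0 & {in P, forall D, v *m D = 0}).
Proof.
move=> P0 Psub.
have Psing D : D \in P -> \det D = 0 by move=> PD; rewrite -[D]subr0 Psub.
have [/exists_inP[D1 PD1 D1_neq0]|P_eq0] := boolP [exists D in P, D != 0];
  last first.
  left; exists (const_mx 1).
    by apply/eqP => /matrixP/(_ 0 0)/eqP; rewrite !mxE oner_eq0.
  move=> D PD; apply/eqP; move: P_eq0; rewrite negb_exists_in.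
  by move/forall_inP/(_ D PD); rewrite negbK => /eqP->; rewrite mul0mx.
have [x1 [y1 D1E]] := singular22_factor (Psing _ PD1).
(* As [D1] is nonzero of rank one, [u] spans its right kernel and [v] its left kernel, so these are
   the only candidates up to scalars. *)
pose u : 'cV[F]_2 := \col_i (if i == 0 then y1 1 else - y1 0).
pose v : 'rV[F]_2 := \row_j (if j == 0 then x1 1 else - x1 0).
have mulDu (D : 'M[F]_2) (x y : 'I_2 -> F) i : (forall i j, D i j = x i * y j) ->
    (D *m u) i 0 = - (x i * wedge y1 y).
  by move=> DE; rewrite mxE sum_ord2 !mxE /= !DE /wedge; ring.
have mulvD (D : 'M[F]_2) (x y : 'I_2 -> F) j : (forall i j, D i j = x i * y j) ->
    (v *m D) 0 j = - (wedge x1 x * y j).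
  by move=> DE; rewrite mxE sum_ord2 !mxE /= !DE /wedge; ring.
have u0 : u != 0.
  apply: contra_neq D1_neq0 => /matrixP u0; apply/matrixP=> i j.
  have:= u0 0 0; have:= u0 1 0; rewrite D1E !mxE /= => /eqP; rewrite oppr_eq0.
  move=> /eqP y10 y11; case: (ord2P j) => ->; by rewrite ?y10 ?y11 mulr0.
have v0 : v != 0.
  apply: contra_neq D1_neq0 => /matrixP v0; apply/matrixP=> i j.
  have:= v0 0 0; have:= v0 0 1; rewrite D1E !mxE /= => /eqP; rewrite oppr_eq0.
  move=> /eqP x10 x11; case: (ord2P i) => ->; by rewrite ?x10 ?x11 mul0r.
have [/forall_inP Pu|] := boolP [forall D in P, D *m u == 0].
  by left; exists u => // D /Pu/eqP.
have [/forall_inP Pv _|] := boolP [forall D in P, v *m D == 0].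
  by right; exists v => // D /Pv/eqP.
(* Suppose [u] fails on [D2] and [v] fails on [D3]: [y2] is not parallel to [y1], nor [x3] to [x1].
   Singularity of [D1 - D2] and [D1 - D3] then makes [x2] parallel to [x1] and [y3] to [y1], so both
   wedges in the determinant of [D2 - D3] are nonzero, a contradiction. *)
rewrite !negb_forall_in => /exists_inP[D3 PD3 vD3] /exists_inP[D2 PD2 D2u].
have [x2 [y2 D2E]] := singular22_factor (Psing _ PD2).
have [x3 [y3 D3E]] := singular22_factor (Psing _ PD3).
have /cV0Pn[i] := D2u; rewrite (mulDu _ _ _ _ D2E) oppr_eq0 mulf_eq0 negb_or.
move=> /andP[x2i y12].
have /rV0Pn[j] := vD3; rewrite (mulvD _ _ _ _ D3E) oppr_eq0 mulf_eq0 negb_or.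
move=> /andP[x13 y3j].
have := Psub _ _ PD1 PD2; rewrite (det_rank1_sub D1E D2E) => /eqP.
rewrite oppr_eq0 mulf_eq0 (negPf y12) orbF => /eqP x12.
have := Psub _ _ PD1 PD3; rewrite (det_rank1_sub D1E D3E) => /eqP.
rewrite oppr_eq0 mulf_eq0 (negPf x13) => /eqP y13.
have := Psub _ _ PD2 PD3; rewrite (det_rank1_sub D2E D3E) => /eqP.
rewrite oppr_eq0 mulf_eq0 (negPf (wedge_neq0 x2i x12 x13)) /=.
by rewrite wedgeC oppr_eq0 (negPf (wedge_neq0 y3j y13 y12)).
Qed.

Lemma GLval_unitmx A : GLval A \in unitmx.
Proof. exact: GL_unit. Qed.

Lemma intersectingP S :
  reflect {in S &, forall A B, \det (GLval A - GLval B) = 0} (intersecting S).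
Proof.
have agree A B : [exists u in Omega F, GLval A *m u == GLval B *m u]
                   = (\det (GLval A - GLval B) == 0).
  apply/exists_inP/det0_cVP => [[u]|[u u0 /eqP]].
    rewrite !inE andbT => u0 /eqP ABu.
    by exists u; rewrite // mulmxBl ABu subrr.
  by rewrite mulmxBl subr_eq0 => ABu; exists u; rewrite // !inE u0.
apply: (iffP forall_inP) => [H A B SA SB | H A SA].
  by apply/eqP; rewrite -agree; have /forall_inP := H _ SA; apply.
by apply/forall_inP=> B SB; rewrite agree H.
Qed.

Definition col_agree (u : 'cV[F]_2) A : {set {'GL_2[F]}} :=
  [set B : {'GL_2[F]} | GLval B *m u == GLval A *m u].

Definition row_agree (v : 'rV[F]_2) A : {set {'GL_2[F]}} :=
  [set B : {'GL_2[F]} | v *m GLval B == v *m GLval A].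

Lemma intersecting_col_agree u A : u != 0 -> intersecting (col_agree u A).
Proof.
move=> u0; apply/intersectingP => B C; rewrite !inE => /eqP Bu /eqP Cu.
by apply/eqP/det0_cVP; exists u; rewrite // mulmxBl Bu Cu subrr.
Qed.

Lemma intersecting_row_agree v A : v != 0 -> intersecting (row_agree v A).
Proof.
move=> v0; apply/intersectingP => B C; rewrite !inE => /eqP Bv /eqP Cv.
by apply/eqP/det0P; exists v; rewrite // mulmxBr Bv Cv subrr.
Qed.

(** The first standard basis vector, written as the rank-one normal form that [mulmx_ebase]
    produces. *)
Definition basis_col : 'cV[F]_2 := pid_mx 1.

(** Singular matrices are sent to the identity as a junk value. *)
Definition mxGL (M : 'M[F]_2) : {'GL_2[F]} := insubd (1%g : {'GL_2[F]}) M.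

Lemma mxGLK (M : 'M[F]_2) : M \in unitmx -> GLval (mxGL M) = M.
Proof. by move=> Mu; rewrite /mxGL -[LHS]/(val _) val_insubd Mu. Qed.

Definition trGL A : {'GL_2[F]} := mxGL (GLval A)^T.

Lemma trGLE A : GLval (trGL A) = (GLval A)^T.
Proof. by rewrite mxGLK // unitmx_tr GLval_unitmx. Qed.

(** Gaussian elimination writes [u] as an invertible matrix times [basis_col] times a 1 by 1 unit;
    that scalar is absorbed into the matrix. *)
Lemma GL2_transitive (u : 'cV[F]_2) :
  u != 0 -> exists g, GLval g *m basis_col = u.
Proof.
move=> u0; have ru : \rank u = 1%N.
  by apply/eqP; rewrite eqn_leq rank_leq_col lt0n mxrank_eq0.
have Uu := row_ebase_unit u; rewrite unitmxE [row_ebase u]mx11_scalar det_scalar1 in Uu.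
exists (mxGL (row_ebase u 0 0 *: col_ebase u)).
rewrite mxGLK; last by rewrite unitmxZ // col_ebase_unit.
rewrite -[RHS]mulmx_ebase ru [row_ebase u]mx11_scalar mul_mx_scalar.
by rewrite scalemxAl mxE eqxx mulr1n.
Qed.

Lemma card_col_agree u A : u != 0 -> #|col_agree u A| = #|col_agree basis_col 1%g|.
Proof.
move=> /GL2_transitive [g gu].
(* Translation by [A^-1] turns agreement with [A] at [u] into fixing [u]; conjugation by [g] then
   moves [u] to [basis_col]. *)
have inj : injective (fun B => g^-1 * (A^-1 * B) * g)%g.
  by move=> B C /mulIg /mulgI /mulgI.
rewrite -[RHS](card_preimset _ inj); apply: eq_card => B; rewrite !inE.
rewrite !GL_MxE !GL_VxE GL_1E mul1mx -!mulmxA gu.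
apply/eqP/eqP => [->|eqB].
  by rewrite mulKmx ?GLval_unitmx // -gu mulKmx ?GLval_unitmx.
by rewrite -[u in RHS]gu -eqB !mulKVmx ?GLval_unitmx.
Qed.

Lemma card_row_agree v A : v != 0 -> #|row_agree v A| = #|col_agree basis_col 1%g|.
Proof.
move=> v0; rewrite -(@card_col_agree v^T (trGL A)) ?trmx_eq0 //.
have inj : injective trGL.
  by move=> B C BC; apply: val_inj; apply: trmx_inj; rewrite /= -!trGLE BC.
rewrite -[RHS](card_preimset _ inj); apply: eq_card => B.
by rewrite !inE !trGLE -!trmx_mul (inj_eq trmx_inj).
Qed.

Lemma intersecting_sub_agree S : intersecting S ->
  exists T : {set {'GL_2[F]}},
    [/\ S \subset T, intersecting T & #|T| = #|col_agree basis_col 1%g|].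
Proof.
move=> /intersectingP Sint; have [->|[A SA]] := set_0Vmem S.
  (* An empty [S] offers no base point [A], but any set of the common size contains it. *)
  exists (col_agree basis_col 1%g); split; rewrite ?sub0set //.
  by apply: intersecting_col_agree; rewrite -mxrank_eq0 rank_pid_mx.
(* Subtracting [A] puts 0 in the family and leaves the pairwise differences unchanged. *)
have [||[u u0 Pu]|[v v0 Pv]] :=
  @singular_family_kernel [set GLval B - GLval A | B in S].
- by apply/imsetP; exists A; rewrite // subrr.
- move=> _ _ /imsetP[B SB ->] /imsetP[C SC ->].
  by rewrite opprB addrA subrK Sint.
- exists (col_agree u A); split;
    [|exact: intersecting_col_agree|exact: card_col_agree].
  apply/subsetP=> B SB; rewrite inE -subr_eq0 -mulmxBl.
  exact/eqP/Pu/imset_f.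
exists (row_agree v A); split;
  [|exact: intersecting_row_agree|exact: card_row_agree].
apply/subsetP=> B SB; rewrite inE -subr_eq0 -mulmxBr.
exact/eqP/Pv/imset_f.
Qed.

End IntersectingGL2.

Theorem corollary1p3 (F : finFieldType) (S : {set {'GL_2[F]}}) :
  maximal_intersecting S -> maximum_intersecting S.
Proof.
move=> /maxsetP [Sint Smax]; split=> // S' S'int.
have [T [sST Tint cT]] := intersecting_sub_agree Sint.
have [T' [sST' _ cT']] := intersecting_sub_agree S'int.
(* Maximality forces [T = S], so [S] has the common cardinality, which bounds that of [S'] through
   [T']. *)
by rewrite -(Smax T Tint sST) cT -cT' subset_leq_card.
Qed.
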